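(* Let $G$ be a gyrogroup, let $M(G)$ be its Grothendieck group completion, and let $V$ be a vector space over an algebraically closed field $k$. Then there is a one-to-one correspondence between the set of all gyrogroup representations $G\to GL(V)$ and the set of all group representations $M(G)\to GL(V)$.
   Context: A gyrogroup is a non-empty set $G$ with a binary operation $\circ$ such that: (1) there is $e\in G$ with $e\circ a=a$ for all $a\in G$; (2) for each $a\in G$ there is $a^{-1}\in G$ with $a^{-1}\circ a=e$; (3) for all $a,b\in G$ there is an automorphism $\mathrm{gyr}[a,b]$ of $(G,\circ)$ with $a\circ(b\circ c)=(a\circ b)\circ \mathrm{gyr}[a,b]c$ for all $c\in G$; (4) $\mathrm{gyr}[a\circ b,b]=\mathrm{gyr}[a,b]$ for all $a,b\in G$. A gyrogroup representation of $G$ on $V$ is a map $\rho:G\to GL(V)$ with $\rho(a\circ b)=\rho(a)\rho(b)$ for all $a,b\in G$. Grothendieck group completion. Put $G^*=G\setminus\{e\}$. Each $f\in \mathrm{Sym}(G^* )$ is regarded as a permutation of $G$ by setting $f(e)=e$. For $f\in\mathrm{Sym}(G^* )$ and $a\in G$, let $\sigma_a(f)\in\mathrm{Sym}(G^* )$ be defined by $f(a)\circ\sigma_a(f)(b)=f(a\circ b)$. The set $G\times\mathrm{Sym}(G^* )$ is a group under $(a,f)\cdot(b,g)=(a\circ f(b),\ \mathrm{gyr}[a,f(b)]\,\sigma_b(f)\,g)$, with identity $(e,I)$, where $I$ is the identity map. Let $R(G)\le \mathrm{Sym}(G^* )$ be the subgroup generated by all $\mathrm{gyr}[a,b]$, $a,b\in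 G$, identified with $\{e\}\times R(G)$, and identify $a \in G$ with $(a,I)$. The subgroup generated by $G\times\{I\}$ is $G R(G):=G\times R(G)$. Let $[R(G)]$ be the smallest normal subgroup of $GR(G)$ containing $\{e\}\times R(G)$. Put $M(G)=GR(G)/[R(G)]$ and $\nu:G\to M(G)$, $\nu(a)=(a,I)[R(G)]$. The pair $(M(G),\nu)$ is the Grothendieck group completion of $G$. *)

(* Defs.v *)
From HB Require Import structures.
From mathcomp Require Import all_boot ssralg.
From mathcomp Require Import boolp classical_sets.

Set Implicit Arguments.
Unset Strict Implicit.
Unset Printing Implicit Defensive.

Import GRing.Theory.
Local Open Scope classical_set_scope.
Local Open Scope quotient_scope.
Local Open Scope group_scope.

Section Groups.
Variable T : groupType.

Definition subgroup (H : set T) : Prop :=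
  [/\ H 1, forall x y, H x -> H y -> H (x * y) & forall x, H x -> H x^-1].

Definition normal_subgroup (H : set T) : Prop :=
  subgroup H /\ forall x y, H y -> H (y ^ x).

Lemma subgroup_smallest (S : set T) : subgroup (smallest subgroup S).
Proof.
split=> [H [[H1 _ _] _] //|x y Sx Sy H HS|x Sx H HS].
  by have [[_ HM _] _] := HS; apply: HM; [apply: Sx|apply: Sy].
by have [[_ _ HV] _] := HS; apply: HV; apply: Sx.
Qed.

Lemma normal_subgroup_smallest (S : set T) :
  normal_subgroup (smallest normal_subgroup S).
Proof.
split; last by move=> x y Sy H HS; have [[_ HJ] _] := HS; apply: HJ; apply: Sy.
split=> [H [[[H1 _ _] _] _] //|x y Sx Sy H HS|x Sx H HS].
  by have [[[_ HM _] _] _] := HS; apply: HM; [apply: Sx|apply: Sy].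
by have [[[_ _ HV] _] _] := HS; apply: HV; apply: Sx.
Qed.

Record normalSubgroup := NormalSubgroup {
  nsg_set : set T;
  nsgP : normal_subgroup nsg_set
}.

Section QuotientGroup.
Variable N : normalSubgroup.

Definition coset_rel : rel T := [rel x y | `[< nsg_set N (x^-1 * y) >]].

Lemma nsg1 : nsg_set N 1. Proof. by case: (nsgP N) => -[]. Qed.
Lemma nsgM x y : nsg_set N x -> nsg_set N y -> nsg_set N (x * y).
Proof. by case: (nsgP N) => -[_ + _] _; apply. Qed.
Lemma nsgV x : nsg_set N x -> nsg_set N x^-1.
Proof. by case: (nsgP N) => -[_ _ +] _; apply. Qed.
Lemma nsgJ x y : nsg_set N y -> nsg_set N (y ^ x).
Proof. by case: (nsgP N) => _; apply. Qed.

Lemma coset_rel_refl : reflexive coset_rel.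
Proof. by move=> x; apply/asboolP; rewrite mulVg; apply: nsg1. Qed.

Lemma coset_rel_sym : symmetric coset_rel.
Proof.
suff h x y : coset_rel x y -> coset_rel y x by move=> x y; apply/idP/idP; exact: h.
by move=> /asboolP/nsgV h; apply/asboolP; rewrite invgM invgK in h.
Qed.

Lemma coset_rel_trans : transitive coset_rel.
Proof.
move=> y x z /asboolP xy /asboolP yz; apply/asboolP.
by have := nsgM xy yz; rewrite -mulgA mulVKg.
Qed.

Canonical coset_equiv :=
  EquivRel coset_rel coset_rel_refl coset_rel_sym coset_rel_trans.

Definition quotient_group := {eq_quot coset_equiv}.

HB.instance Definition _ := Choice.on quotient_group.
HB.instance Definition _ := EqQuotient.on quotient_group.

Lemma quotgP (x y : T) :
  reflect (nsg_set N (x^-1 * y)) (\pi_quotient_group x == \pi_quotient_group y).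
Proof. by rewrite eqmodE; apply: asboolP. Qed.

Definition quotg_one : quotient_group := \pi_quotient_group 1.
Definition quotg_mul (x y : quotient_group) : quotient_group :=
  \pi_quotient_group (repr x * repr y).
Definition quotg_inv (x : quotient_group) : quotient_group := \pi_quotient_group (repr x)^-1.

Lemma quotg_repr (x : T) : nsg_set N (x^-1 * repr (\pi_quotient_group x)).
Proof. by apply/quotgP; rewrite reprK. Qed.

Lemma quotg_piM (x y : T) :
  \pi_quotient_group (x * y) = quotg_mul (\pi x) (\pi y).
Proof.
apply/eqP/quotgP; set x' := repr _; set y' := repr _.
have -> : (x * y)^-1 * (x' * y') = (x^-1 * x') ^ y * (y^-1 * y').
  by rewrite invgM /conjg -!mulgA mulVKg.
by apply: nsgM; [apply: nsgJ|]; apply: quotg_repr.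
Qed.

Lemma quotg_piV (x : T) : \pi_quotient_group x^-1 = quotg_inv (\pi x).
Proof.
apply/eqP/quotgP; rewrite invgK; set x' := repr _.
have -> : x * x'^-1 = ((x^-1 * x')^-1) ^ (x^-1).
  by rewrite /conjg invgM !invgK mulgK.
by apply/nsgJ/nsgV/quotg_repr.
Qed.

Lemma quotg_mulA : associative quotg_mul.
Proof.
elim/quotW=> x; elim/quotW=> y; elim/quotW=> z.
by rewrite -!quotg_piM mulgA.
Qed.
Lemma quotg_mul1 : left_id quotg_one quotg_mul.
Proof. by elim/quotW=> x; rewrite -quotg_piM mul1g. Qed.
Lemma quotg_mulr1 : right_id quotg_one quotg_mul.
Proof. by elim/quotW=> x; rewrite -quotg_piM mulg1. Qed.
Lemma quotg_mulV : left_inverse quotg_one quotg_inv quotg_mul.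
Proof. by elim/quotW=> x; rewrite -quotg_piV -quotg_piM mulVg. Qed.
Lemma quotg_mulrV : right_inverse quotg_one quotg_inv quotg_mul.
Proof. by elim/quotW=> x; rewrite -quotg_piV -quotg_piM mulgV. Qed.

HB.instance Definition _ := isGroup.Build quotient_group
  quotg_mulA quotg_mul1 quotg_mulr1 quotg_mulV quotg_mulrV.

End QuotientGroup.
End Groups.

Arguments subgroup {T} H.
Arguments normal_subgroup {T} H.

Section BijInverse.
Variables (A : Type) (f : A -> A) (fB : bijective f).

Lemma bij_inverse_ex : exists g, cancel f g /\ cancel g f.
Proof. by case: fB => g fK gK; exists g. Qed.

Definition bij_inverse : A -> A := sval (cid bij_inverse_ex).

Lemma bij_inverseK : cancel f bij_inverse.
Proof. by rewrite /bij_inverse; case: cid => g []. Qed.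
Lemma bij_inverseVK : cancel bij_inverse f.
Proof. by rewrite /bij_inverse; case: cid => g []. Qed.
Lemma bij_inverse_bij : bijective bij_inverse.
Proof. by exists f; [exact: bij_inverseVK|exact: bij_inverseK]. Qed.
End BijInverse.

HB.mixin Record isGyrogroup (G : Type) := {
  gyop : G -> G -> G;
  gye : G;
  gyinv : G -> G;
  gyr : G -> G -> G -> G;
  gyop1 : left_id gye gyop;
  gyopV : left_inverse gye gyinv gyop;
  gyr_bij : forall a b, bijective (gyr a b);
  gyrM : forall a b, {morph gyr a b : c d / gyop c d};
  gyopA : forall a b c, gyop a (gyop b c) = gyop (gyop a b) (gyr a b c);
  gyr_loop : forall a b, gyr (gyop a b) b =1 gyr a b
}.

#[short(type="gyrogroupType")]
HB.structure Definition Gyrogroup := {G of isGyrogroup G}.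

Arguments gye {s}.

Declare Scope gyro_scope.
Delimit Scope gyro_scope with gyro.
Notation "a \o+ b" := (gyop a b) (at level 50, left associativity) : gyro_scope.
Local Open Scope gyro_scope.

Section GyrogroupTheory.
Variable G : gyrogroupType.
Implicit Types a b c : G.

Lemma gyop_inj a : injective (gyop a).
Proof.
move=> b c /(congr1 (gyop (gyinv a))); rewrite !gyopA gyopV !gyop1.
exact/bij_inj/gyr_bij.
Qed.

Lemma gyr1l b : gyr gye b =1 id.
Proof. by move=> c; apply: (@gyop_inj b); rewrite -{1}(gyop1 b) -gyopA gyop1. Qed.

Lemma gyop_invK a : cancel (gyop a) (gyop (gyinv a)).
Proof. by move=> b; rewrite gyopA -gyr_loop gyopV gyr1l gyop1. Qed.

Lemma gyopr1 a : a \o+ gye = a.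
Proof. by apply: (@gyop_inj (gyinv a)); rewrite gyop_invK gyopV. Qed.

Lemma gyinvK a : gyinv (gyinv a) = a.
Proof. by rewrite -[LHS]gyopr1 -(gyopV a) gyop_invK. Qed.

Lemma gyop_invVK a : cancel (gyop (gyinv a)) (gyop a).
Proof. by move=> b; rewrite -{1}(gyinvK a) gyop_invK. Qed.

Lemma gyoprV a : a \o+ gyinv a = gye.
Proof. by rewrite -{1}(gyinvK a) gyopV. Qed.

Lemma gyop_bij a : bijective (gyop a).
Proof. by exists (gyop (gyinv a)); [exact: gyop_invK|exact: gyop_invVK]. Qed.

Lemma gyr_e a b : gyr a b gye = gye.
Proof.
by apply: (@gyop_inj (gyr a b gye)); rewrite -gyrM gyop1 gyopr1.
Qed.

End GyrogroupTheory.

(* Sym(G^* ), with G^* = G \ {e}: a permutation of G^* is encoded as its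
   extension to G by e |-> e, that is, as a permutation of G fixing e. *)
Record symStar (G : gyrogroupType) := SymStar {
  sym_fun :> G -> G;
  sym_bij : bijective sym_fun;
  sym_e : sym_fun gye = gye
}.

HB.instance Definition _ (G : gyrogroupType) := gen_eqMixin (symStar G).
HB.instance Definition _ (G : gyrogroupType) := gen_choiceMixin (symStar G).

Section SymStarGroup.
Variable G : gyrogroupType.
Implicit Types (a b c : G) (f g h : symStar G).

Lemma sym_ext f g : f =1 g -> f = g.
Proof.
case: f g => f fb fe [g gb ge] /= /funext fg; case: _ / fg in gb ge *.
by congr SymStar; apply: Prop_irrelevance.
Qed.

Definition sym_one : symStar G :=
  @SymStar G id (Bijective (frefl _) (frefl _)) erefl.

Lemma sym_mul_bij f g : bijective (f \o g).
Proof. by apply: bij_comp; apply: sym_bij. Qed.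
Lemma sym_mul_e f g : (f \o g) gye = gye.
Proof. by rewrite /= !sym_e. Qed.
Definition sym_mul f g := SymStar (sym_mul_bij f g) (sym_mul_e f g).

Lemma sym_inv_e f : bij_inverse (sym_bij f) gye = gye.
Proof. by rewrite -{1}(sym_e f) bij_inverseK. Qed.
Definition sym_inv f := SymStar (bij_inverse_bij (sym_bij f)) (sym_inv_e f).

Lemma sym_mulA : associative sym_mul.
Proof. by move=> f g h; apply: sym_ext. Qed.
Lemma sym_mul1 : left_id sym_one sym_mul.
Proof. by move=> f; apply: sym_ext. Qed.
Lemma sym_mulr1 : right_id sym_one sym_mul.
Proof. by move=> f; apply: sym_ext. Qed.
Lemma sym_mulV : left_inverse sym_one sym_inv sym_mul.
Proof. by move=> f; apply: sym_ext => x /=; rewrite bij_inverseK. Qed.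
Lemma sym_mulrV : right_inverse sym_one sym_inv sym_mul.
Proof. by move=> f; apply: sym_ext => x /=; rewrite bij_inverseVK. Qed.

HB.instance Definition _ := isGroup.Build (symStar G)
  sym_mulA sym_mul1 sym_mulr1 sym_mulV sym_mulrV.

Definition sgyr a b : symStar G := SymStar (gyr_bij a b) (gyr_e a b).

(* sigma_a(f), determined by f(a) o sigma_a(f)(b) = f(a o b): see sigmaE. *)
Definition sigma_fun a f b : G := gyinv (f a) \o+ f (a \o+ b).
Lemma sigma_bij a f : bijective (sigma_fun a f).
Proof.
apply: (bij_comp (gyop_bij (gyinv (f a)))).
exact: (bij_comp (sym_bij f) (gyop_bij a)).
Qed.
Lemma sigma_e a f : sigma_fun a f gye = gye.
Proof. by rewrite /sigma_fun gyopr1 gyopV. Qed.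
Definition sigma a f : symStar G := SymStar (sigma_bij a f) (sigma_e a f).

Lemma sigmaE a f b : f a \o+ sigma a f b = f (a \o+ b).
Proof. exact: gyop_invVK. Qed.

End SymStarGroup.

(* G x Sym(G^* ). A record rather than a product type, because its group law
   is not the componentwise one. *)
Record gyroSym (G : gyrogroupType) := GyroSym {
  gs_elt : G;
  gs_sym : symStar G
}.

HB.instance Definition _ (G : gyrogroupType) := gen_eqMixin (gyroSym G).
HB.instance Definition _ (G : gyrogroupType) := gen_choiceMixin (gyroSym G).

Section GyroSymGroup.
Variable G : gyrogroupType.
Implicit Types (a b c : G) (x y : gyroSym G).

Definition gs_one : gyroSym G := GyroSym gye 1.

Definition gs_mul x y : gyroSym G :=
  let: GyroSym a f := x in
  let: GyroSym b g := y in
  GyroSym (a \o+ f b) (sgyr a (f b) * sigma b f * g).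

(* (a, f) |-> (z |-> a o f(z)) is an injective morphism into the permutations
   of G, from which the group axioms follow. *)
Definition gs_act x (z : G) : G := gs_elt x \o+ gs_sym x z.

Lemma gs_act_inj x y : gs_act x =1 gs_act y -> x = y.
Proof.
case: x y => [a f] [b g] h; rewrite /gs_act /= in h.
have ab : a = b by have := h gye; rewrite !sym_e !gyopr1.
subst b; congr GyroSym; apply: sym_ext => z; exact/gyop_inj/h.
Qed.

Lemma gs_act1 : gs_act gs_one =1 id.
Proof. by move=> z; rewrite /gs_act gyop1. Qed.

Lemma gs_actM x y : gs_act (gs_mul x y) =1 gs_act x \o gs_act y.
Proof.
case: x y => [a f] [b g] z; rewrite /gs_act /=.
by rewrite -gyopA -[sigma_fun _ _ _]/(sigma b f (g z)) sigmaE.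
Qed.

Definition gs_inv x : gyroSym G :=
  let: GyroSym a f := x in
  GyroSym (f^-1 (gyinv a)) (sigma (gyinv a) f^-1).

Lemma gs_actV x : gs_act (gs_inv x) =1 fun z =>
  (gs_sym x)^-1 (gyinv (gs_elt x) \o+ z).
Proof. by case: x => a f z; rewrite /gs_act /gs_inv sigmaE. Qed.

Lemma gs_mulA : associative gs_mul.
Proof. by move=> x y z; apply: gs_act_inj => u; rewrite !gs_actM /= !gs_actM. Qed.
Lemma gs_mul1 : left_id gs_one gs_mul.
Proof. by move=> x; apply: gs_act_inj => u; rewrite gs_actM /= gs_act1. Qed.
Lemma gs_mulr1 : right_id gs_one gs_mul.
Proof. by move=> x; apply: gs_act_inj => u; rewrite gs_actM /= gs_act1. Qed.
Lemma gs_mulV : left_inverse gs_one gs_inv gs_mul.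
Proof.
move=> x; apply: gs_act_inj => u; rewrite gs_actM /= gs_actV gs_act1.
by rewrite /gs_act gyop_invK /= bij_inverseK.
Qed.
Lemma gs_mulrV : right_inverse gs_one gs_inv gs_mul.
Proof.
move=> x; apply: gs_act_inj => u; rewrite gs_actM /= gs_actV gs_act1.
by rewrite /gs_act /= bij_inverseVK gyop_invVK.
Qed.

HB.instance Definition _ := isGroup.Build (gyroSym G)
  gs_mulA gs_mul1 gs_mulr1 gs_mulV gs_mulrV.

End GyroSymGroup.

Section Completion.
Variable G : gyrogroupType.
Implicit Types (a b c : G) (f g : symStar G).

Definition RG : set (symStar G) :=
  smallest subgroup [set f | exists a b, f = sgyr a b].

Lemma RG_morph f : RG f -> {morph f : a b / a \o+ b}.
Proof.
move: f; apply: (@smallest_sub _ _ _ [set f : symStar G | {morph f : a b / a \o+ b}]).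
  split=> [//|f g fM gM a b|f fM a b] /=; first by rewrite gM fM.
  apply: (bij_inj (sym_bij f)).
  by rewrite fM !bij_inverseVK.
by move=> f [a [b ->]]; apply: gyrM.
Qed.

Lemma RG_sigma a f : RG f -> sigma a f = f.
Proof.
move=> /RG_morph fM; apply: sym_ext => b.
by apply: (@gyop_inj _ (f a)); rewrite sigmaE fM.
Qed.

Definition GR_pred : {pred gyroSym G} := [pred x | `[< RG (gs_sym x) >]].

(* The group G R(G) = G x R(G); see GR_generated for the fact that it is the
   subgroup generated by G x {I}. *)
Record GR := MkGR { GRval :> gyroSym G; GRP : GRval \in GR_pred }.

HB.instance Definition _ := [isSub for GRval].
HB.instance Definition _ := [Choice of GR by <:].

Lemma GR_group_closed : group_closed GR_pred.
Proof.
have [R1 RM RV] := subgroup_smallest [set f | exists a b, f = sgyr a b].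
split; first exact/asboolP.
move=> [a f] [b g] /asboolP /= Rf /asboolP /= Rg; apply/asboolP => /=.
have RgV : RG g^-1 by apply: RV.
rewrite !RG_sigma //; apply: (RM) => //; apply: (RM) => //.
by apply: sub_gen_smallest; do 2!eexists.
Qed.

HB.instance Definition _ :=
  SubChoice_isSubGroup.Build (gyroSym G) GR_pred GR GR_group_closed.

Lemma GR_elt_subproof a : GyroSym a 1 \in GR_pred.
Proof. by apply/asboolP; case: (subgroup_smallest [set f | exists a b, f = sgyr a b]). Qed.

Definition GR_elt a : GR := MkGR (GR_elt_subproof a).

Lemma GR_generated :
  smallest subgroup [set GyroSym a 1 | a in [set: G]]
  = [set x | x \in GR_pred].
Proof.
apply/seteqP; split.
  apply: smallest_sub; last by move=> _ [a _ <-]; exact: GR_elt_subproof.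
  split=> [|x y xG yG|x xG] /=.
  - exact: GR_group_closed.1.
  - exact: (group_closedM GR_group_closed).
  - exact: (group_closedV GR_group_closed).
move=> [a f] /asboolP /= Rf.
set S := [set _ | _ in _]; have [S1 SM SV] := subgroup_smallest S.
have Sa b : smallest subgroup S (GyroSym b 1).
  by apply: sub_gen_smallest; exists b.
have mulE b g : GyroSym b g = GyroSym b 1 * GyroSym gye g.
  by apply: gs_act_inj => z; rewrite gs_actM /gs_act /= gyop1.
rewrite mulE; apply: (SM) => //; move: f Rf.
have eM f g : GyroSym gye (f * g) = GyroSym gye f * GyroSym gye g.
  by apply: gs_act_inj => z; rewrite gs_actM /gs_act /= !gyop1.
apply: (@smallest_sub _ _ _ [set f | smallest subgroup S (GyroSym gye f)]).
  split=> [//|f g Sf Sg|f Sf] /=; first by rewrite eM; apply: (SM).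
  suff -> : GyroSym gye f^-1 = (GyroSym gye f)^-1 by apply: (SV).
  by apply: (can_inj (mulKg (GyroSym gye f))); rewrite -eM !mulgV.
move=> _ [b [c ->]] /=.
have -> : GyroSym gye (sgyr b c)
    = (GyroSym (b \o+ c) 1)^-1 * (GyroSym b 1 * GyroSym c 1).
  apply: (can_inj (mulKg (GyroSym (b \o+ c) 1))); rewrite mulVKg.
  by apply: gs_act_inj => z; rewrite !gs_actM /gs_act /= gyop1 gyopA.
by apply: (SM) => //; [apply: SV|apply: SM].
Qed.

(* The generating set is {e} x R(G): a pair in GR has its second component in
   R(G), so only the first one has to be constrained. *)
Definition RG_closure : normalSubgroup GR :=
  NormalSubgroup (normal_subgroup_smallest
    [set x : GR | gs_elt (GRval x) = gye]).

Definition MG : Type := quotient_group RG_closure.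
HB.instance Definition _ := Group.on MG.

Definition nu a : MG := \pi_(quotient_group RG_closure) (GR_elt a).

End Completion.

Section GeneralLinear.
Variables (k : fieldType) (V : lmodType k).

Record GL := MkGL {
  GLfun :> {linear V -> V};
  GL_bij : bijective GLfun
}.

HB.instance Definition _ := gen_eqMixin GL.
HB.instance Definition _ := gen_choiceMixin GL.

Lemma GL_ext (f g : GL) : f =1 g -> f = g.
Proof.
case: f g => f fb [g gb] /= fg.
have {}fg : f = g :> {linear V -> V}.
  case: f g fg {fb gb} => f [[f1] [f2]] [g [[g1] [g2]]] /= /funext fg.
  by case: _ / fg in g1 g2 *; rewrite (Prop_irrelevance f1 g1) (Prop_irrelevance f2 g2).
by case: _ / fg in gb *; congr MkGL; apply: Prop_irrelevance.
Qed.

Definition GL_one : GL :=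
  @MkGL (idfun : {linear V -> V}) (Bijective (frefl _) (frefl _)).

Definition GL_mul (f g : GL) : GL :=
  @MkGL (f \o g : {linear V -> V}) (bij_comp (GL_bij f) (GL_bij g)).

Section Inverse.
Variable f : GL.
Lemma GL_inv_linear : linear (bij_inverse (GL_bij f)).
Proof.
by move=> a u v; apply: (bij_inj (GL_bij f)); rewrite linearP !bij_inverseVK.
Qed.
HB.instance Definition _ :=
  GRing.isLinear.Build k V V *:%R (bij_inverse (GL_bij f)) GL_inv_linear.
Definition GL_inv : GL :=
  @MkGL (bij_inverse (GL_bij f) : {linear V -> V}) (bij_inverse_bij (GL_bij f)).
End Inverse.

Lemma GL_mulA : associative GL_mul.
Proof. by move=> f g h; apply: GL_ext. Qed.
Lemma GL_mul1 : left_id GL_one GL_mul.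
Proof. by move=> f; apply: GL_ext. Qed.
Lemma GL_mulr1 : right_id GL_one GL_mul.
Proof. by move=> f; apply: GL_ext. Qed.
Lemma GL_mulV : left_inverse GL_one GL_inv GL_mul.
Proof. by move=> f; apply: GL_ext => x /=; rewrite bij_inverseK. Qed.
Lemma GL_mulrV : right_inverse GL_one GL_inv GL_mul.
Proof. by move=> f; apply: GL_ext => x /=; rewrite bij_inverseVK. Qed.

HB.instance Definition _ := isGroup.Build GL
  GL_mulA GL_mul1 GL_mulr1 GL_mulV GL_mulrV.

End GeneralLinear.

Record gyrogroup_rep (G : gyrogroupType) (k : fieldType) (V : lmodType k) :=
  GyrogroupRep {
    grep_fun :> G -> GL V;
    grepM : forall a b, grep_fun (a \o+ b) = grep_fun a * grep_fun b
  }.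

(* Main.v *)
(* For a representation rho of G,
     rho (a o b) rho c = rho a rho b rho c = rho (a o b) rho (gyr[a,b] c),
   so rho is invariant under every gyration, hence under R(G).  Therefore
   (a, f) |-> rho a is a group morphism on G R(G) whose kernel contains
   {e} x R(G), and it factors through M(G).  Conversely (a, f) = (a, I)(e, f)
   shows that nu is onto M(G), so a representation of M(G) is determined by its
   composite with nu. *)
Require Import Defs.
From HB Require Import structures.
From mathcomp Require Import all_boot ssralg.
From mathcomp Require Import boolp classical_sets.

Set Implicit Arguments.
Unset Strict Implicit.
Unset Printing Implicit Defensive.

Local Open Scope quotient_scope.
Local Open Scope group_scope.
Local Open Scope gyro_scope.

Lemma multiplicative_ext (S T : groupType) (f g : {multiplicative S -> T}) :
  f =1 g -> f = g.
Proof.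
case: f g => f [[fM]] [g [[gM]]] /= /funext fg; case: _ / fg in gM *.
by rewrite (Prop_irrelevance fM gM).
Qed.

Lemma gyrogroup_rep_ext (G : gyrogroupType) (k : fieldType) (V : lmodType k)
    (rho tau : gyrogroup_rep G V) :
  rho =1 tau -> rho = tau.
Proof.
case: rho tau => f fM [g gM] /= /funext fg; case: _ / fg in gM *.
by rewrite (Prop_irrelevance fM gM).
Qed.

Section QuotientUniversality.
Variables (T H : groupType).

Lemma normal_subgroup_kernel (f : UMagmaMorphism.type T H) :
  normal_subgroup [set x | f x = 1].
Proof.
split; first split=> [/=|x y /= fx fy|x /= fx].
- exact: gmulf1.
- by rewrite gmulfM fx fy mulg1.
- by rewrite gmulfV fx invg1.
by move=> x y /= fy; rewrite gmulfJ fy conj1g.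
Qed.

Lemma quotient_group_lift (N : normalSubgroup T) (f : UMagmaMorphism.type T H) :
    (forall x, nsg_set N x -> f x = 1) ->
  exists phi : {multiplicative quotient_group N -> H},
    forall x, phi (\pi_(quotient_group N) x) = f x.
Proof.
move=> fN; pose phi (q : quotient_group N) := f (repr q).
have phi_pi x : phi (\pi_(quotient_group N) x) = f x.
  (* The chosen representative differs from [x] by an element of [N], which [f] kills. *)
  have := fN _ (quotg_repr N x); rewrite gmulfM gmulfV => fx.
  by apply: (can_inj (mulKg (f x)^-1)); rewrite fx mulVg.
have phiM : {morph phi : p q / p * q}.
  by elim/quotW=> x; elim/quotW=> y; rewrite -[_ * _]quotg_piM !phi_pi gmulfM.
by exists (HB.pack_for {multiplicative quotient_group N -> H} phi
  (isMultiplicative.Build _ _ phi phiM)).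
Qed.

End QuotientUniversality.

Section Completion.
Variable G : gyrogroupType.
Implicit Types (a b c : G) (x y : GR G).

Lemma GR_eltM x y : gs_elt (x * y : GR G) = gs_elt x \o+ gs_sym x (gs_elt y).
Proof. by case: x y => -[a f] ? [[b g] ?]. Qed.

(** Pairs with the same first component differ by an element of {e} x R(G), hence have the same
    class in M(G). *)
Lemma GR_mulV_elt x y : gs_elt x = gs_elt y -> gs_elt (x^-1 * y : GR G) = gye.
Proof.
rewrite GR_eltM => <-; case: x => -[a f] Rf.
rewrite -[LHS]/((f^-1) (gyinv a) \o+ sigma (gyinv a) f^-1 a).
by rewrite sigmaE gyopV sym_e.
Qed.

Lemma pi_nu x : \pi_(quotient_group (RG_closure G)) x = nu (gs_elt x).
Proof. by apply/eqP/quotgP; apply: sub_gen_smallest; apply: GR_mulV_elt. Qed.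

Lemma nu_surj (q : MG G) : exists a, q = nu a.
Proof. by elim/quotW: q => x; exists (gs_elt x); rewrite pi_nu. Qed.

(** In G R(G), (a, I)(b, I) = (a o b, gyr[a,b]), and the class forgets the second component. *)
Lemma nuM a b : nu (a \o+ b) = nu a * nu b.
Proof. by rewrite -[_ * _]quotg_piM pi_nu GR_eltM. Qed.

Section Universality.
Variables (H : groupType) (rho : G -> H).
Hypothesis rhoM : {morph rho : a b / a \o+ b >-> a * b}.

Lemma gyro_morph1 : rho gye = 1.
Proof. by apply: (can_inj (mulKg (rho gye))); rewrite -rhoM gyop1 mulg1. Qed.

Lemma gyro_morph_gyr a b c : rho (gyr a b c) = rho c.
Proof.
by apply: (can_inj (mulKg (rho (a \o+ b)))); rewrite -rhoM -gyopA !rhoM mulgA.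
Qed.

(** The permutations that leave [rho] invariant form a subgroup containing all gyrations. *)
Lemma gyro_morph_RG (f : symStar G) : RG f -> rho \o f =1 rho.
Proof.
move: f; apply: (@smallest_sub _ _ _ [set f : symStar G | rho \o f =1 rho]).
  split=> [//|f g frho grho c|f frho c] /=.
    by rewrite [LHS]frho [LHS]grho.
  by rewrite -[LHS]frho /= bij_inverseVK.
by move=> _ [a [b ->]] c; apply: gyro_morph_gyr.
Qed.

Lemma nu_universal :
  exists phi : {multiplicative MG G -> H}, forall a, phi (nu a) = rho a.
Proof.
pose psi x := rho (gs_elt x).
have psiM : monoid_morphism psi.
  split=> [|x y]; first exact: gyro_morph1.
  (* The product (a, f)(b, g) has first component a o f(b); invariance under f in R(G) removes the
     twist. *)
  rewrite /psi GR_eltM rhoM [rho (gs_sym x _)]gyro_morph_RG //.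
  exact/asboolP/(GRP x).
pose Psi := HB.pack_for (UMagmaMorphism.type (GR G) H) psi
  (isUMagmaMorphism.Build _ _ psi psiM).
have [|phi phiE] := @quotient_group_lift _ _ (RG_closure G) Psi.
  (* The kernel is normal, so it contains the normal closure once it contains the generators. *)
  apply: (@smallest_sub _ _ _ [set x | Psi x = 1]).
    exact: normal_subgroup_kernel.
  by move=> x /= xe; rewrite /psi xe gyro_morph1.
by exists phi => a; apply: phiE.
Qed.

End Universality.
End Completion.

Theorem theorem4p1 (G : gyrogroupType) (k : closedFieldType) (V : lmodType k) :
  exists F : {multiplicative MG G -> GL V} -> gyrogroup_rep G V,
    bijective F /\ forall phi a, F phi a = phi (nu a).
Proof.
have FM (phi : {multiplicative MG G -> GL V}) a b :
    phi (nu (a \o+ b)) = phi (nu a) * phi (nu b).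
  by rewrite nuM gmulfM.
have [F' F'E] := choice (fun rho : gyrogroup_rep G V => nu_universal (grepM rho)).
(* [F] is restriction along [nu]; its inverse [F'] picks an extension of each [rho], unique since
   [nu] is onto. *)
exists (fun phi => GyrogroupRep (FM phi)); split=> //; exists F' => [phi|rho].
  by apply: multiplicative_ext => q; have [a ->] := nu_surj q; rewrite F'E.
by apply: gyrogroup_rep_ext => a /=; rewrite F'E.
Qed.
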